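(* Let $k$ be a field of characteristic $p$, $G$ a profinite group and $B$ a block of $G$ over $k$. Then a defect group of $B$ exists.
   Context: $k$ is a discrete field of prime characteristic $p$. For a profinite group $G$, $k[[G]]=\varprojlim_N k[G/N]$ ($N$ running over open normal subgroups) is the completed group algebra. There is a unique set $E$ of pairwise orthogonal primitive idempotents of $Z(k[[G]])$ with $k[[G]]=\prod_{e\in E}k[[G]]e$; the $k[[G]]e$ are the blocks of $G$ and the $e\in E$ the block idempotents. $G$ acts on $k[[G]]$ by conjugation, ${}^g x=gxg^{-1}$; $k[[G]]^H$ denotes the fixed points of a closed subgroup $H$. For $H$ open in $G$, $\mathrm{Tr}_H^G:k[[G]]^H\to k[[G]]^G$ is $a\mapsto\sum_{g\in G/H}{}^g a$. For $H\le G$ closed, $\mathrm{oTr}_H^G(k[[G]]^H)=\bigcap_{N}\mathrm{Tr}_{HN}^G(k[[G]]^{HN})$, over all open normal subgroups $N$ of $G$. A defect group of a block with block idempotent $e$ is a closed subgroup $D$ of $G$ with $e\in \mathrm{oTr}_D^G(k[[G]]^D)$ and minimal (under inclusion, among closed subgroups) with this property. *)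

(* Defs.v *)
From HB Require Import structures.
From mathcomp Require Import all_boot all_algebra all_fingroup.
From mathcomp Require Import finmap all_classical topology.

Set Implicit Arguments.
Unset Strict Implicit.
Unset Printing Implicit Defensive.

Import GRing.Theory.

Local Open Scope classical_set_scope.
Local Open Scope quotient_scope.
Local Notation repr := generic_quotient.repr.

HB.mixin Record isTopologicalGroup G of monoid.Group G & Topological G := {
  mulg_continuous : continuous (fun xy : G * G => (xy.1 * xy.2)%g);
  invg_continuous : continuous (fun x : G => x^-1%g)
}.

#[short(type="topologicalGroupType")]
HB.structure Definition TopologicalGroup :=
  {G of isTopologicalGroup G & monoid.Group G & Topological G}.

HB.mixin Record isProfinite G of TopologicalGroup G := {
  profinite_compact : compact [set: G];
  profinite_hausdorff : hausdorff_space G;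
  profinite_disconnected : totally_disconnected [set: G]
}.

#[short(type="profiniteGroupType")]
HB.structure Definition ProfiniteGroup :=
  {G of isProfinite G & TopologicalGroup G}.

Section Subgroups.
Variable G : groupType.
Implicit Types H K : set G.

Definition is_subgroup H := group_closed [in H].

Definition left_coset H (g : G) : set G := [set (g * h)%g | h in H].

Definition left_cosets H : set (set G) := [set left_coset H g | g in [set: G]].

Definition setprod_group H K : set G := [set (h * x)%g | h in H & x in K].

End Subgroups.

Definition closed_subgroup (G : topologicalGroupType) (H : set G) :=
  is_subgroup H /\ closed H.

Record openNormal (G : topologicalGroupType) := OpenNormal {
  openNormal_set :> set G;
  openNormal_open : open openNormal_set;
  openNormal_subgroup : is_subgroup openNormal_set;
  openNormal_normal :
    forall x g : G, openNormal_set x -> openNormal_set (x ^ g)%g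
}.

Section OpenNormalTheory.
Variables (G : topologicalGroupType) (N : openNormal G).
Implicit Types x y z : G.

Lemma openNormal1 : openNormal_set N 1%g.
Proof. by have [/set_mem] := openNormal_subgroup N. Qed.

Lemma openNormalM x y :
  openNormal_set N x -> openNormal_set N y -> openNormal_set N (x * y)%g.
Proof.
move=> Nx Ny; have /group_closedM := openNormal_subgroup N.
by move=> /(_ x y (mem_set Nx) (mem_set Ny)) /set_mem.
Qed.

Lemma openNormalV x : openNormal_set N x -> openNormal_set N x^-1%g.
Proof.
move=> Nx; have /group_closedV := openNormal_subgroup N.
by move=> /(_ x (mem_set Nx)) /set_mem.
Qed.

Definition coset_rel : rel G := fun x y => `[< openNormal_set N (x^-1 * y)%g >].

Lemma coset_rel_equiv : equiv_class_of coset_rel.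
Proof.
split=> [x|x y|y x z].
- by rewrite /coset_rel mulVg; exact/asboolP/openNormal1.
- by apply/asboolP/asboolP => /openNormalV; rewrite invgM invgK.
- move=> /asboolP Nxy /asboolP Nyz; apply/asboolP.
  by have := openNormalM Nxy Nyz; rewrite mulgA mulgK.
Qed.

Canonical coset_equiv := EquivRelPack coset_rel_equiv.

End OpenNormalTheory.

(* The quotient group G/N: classes of x ~ y iff xN = yN. *)
Definition quot (G : topologicalGroupType) (N : openNormal G) :=
  {eq_quot (coset_equiv N)}.

Section QuotientGroup.
Variables (G : topologicalGroupType) (N : openNormal G).
Implicit Types (x y z : G) (a b c : quot N).

HB.instance Definition _ := Choice.on (quot N).
HB.instance Definition _ := EqQuotient.on (quot N).

Definition to_quot x : quot N := \pi_(quot N) x.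

Lemma to_quotP x y : to_quot x = to_quot y <-> openNormal_set N (x^-1 * y)%g.
Proof.
split=> [/eqP|Nxy]; first by rewrite /to_quot eqmodE => /asboolP.
by apply/eqP; rewrite /to_quot eqmodE; exact/asboolP.
Qed.

Lemma to_quotK a : to_quot (repr a) = a. Proof. exact: reprK. Qed.

Lemma quotW (P : quot N -> Prop) : (forall x, P (to_quot x)) -> forall a, P a.
Proof. by move=> Px a; rewrite -[a]to_quotK. Qed.

Definition quot_one := to_quot 1%g.
Definition quot_mul a b := to_quot (repr a * repr b)%g.
Definition quot_inv a := to_quot (repr a)^-1%g.

Lemma quot_mulE x y : quot_mul (to_quot x) (to_quot y) = to_quot (x * y)%g.
Proof.
apply/to_quotP; set x' := repr _; set y' := repr _.
have Nx : openNormal_set N (x'^-1 * x)%g by apply/to_quotP; rewrite to_quotK.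
have Ny : openNormal_set N (y'^-1 * y)%g by apply/to_quotP; rewrite to_quotK.
have -> : ((x' * y')^-1 * (x * y) = (x'^-1 * x) ^ y' * (y'^-1 * y))%g.
  by rewrite invgM conjgE !mulgA mulgK.
by apply: openNormalM => //; exact: openNormal_normal.
Qed.

Lemma quot_invE x : quot_inv (to_quot x) = to_quot x^-1%g.
Proof.
apply/to_quotP; set x' := repr _.
have Nx : openNormal_set N (x^-1 * x')%g by apply/to_quotP; rewrite to_quotK.
have -> : (x'^-1^-1 * x^-1 = (x^-1 * x') ^ (x^-1))%g.
  by rewrite conjgE !invgK !mulgA mulgV mul1g.
exact: openNormal_normal.
Qed.

Lemma quot_mulA : associative quot_mul.
Proof.
elim/quotW=> x; elim/quotW=> y; elim/quotW=> z.
by rewrite !quot_mulE mulgA.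
Qed.

Lemma quot_mul1 : left_id quot_one quot_mul.
Proof. by elim/quotW=> x; rewrite quot_mulE mul1g. Qed.

Lemma quot_invK : involutive quot_inv.
Proof. by elim/quotW=> x; rewrite !quot_invE invgK. Qed.

Lemma quot_invM : {morph quot_inv : a b / quot_mul a b >-> quot_mul b a}.
Proof.
by elim/quotW=> x; elim/quotW=> y; rewrite !(quot_mulE, quot_invE) invgM.
Qed.

Lemma quot_mulV : left_inverse quot_one quot_inv quot_mul.
Proof. by elim/quotW=> x; rewrite quot_invE quot_mulE mulVg. Qed.

HB.instance Definition _ :=
  isStarMonoid.Build (quot N) quot_mulA quot_mul1 quot_invK quot_invM.
HB.instance Definition _ := StarMonoid_isGroup.Build (quot N) quot_mulV.

Lemma to_quotM x y : to_quot (x * y)%g = (to_quot x * to_quot y)%g.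
Proof. by rewrite -quot_mulE. Qed.

Lemma to_quot1 : to_quot 1%g = 1%g. Proof. by []. Qed.

Lemma to_quotV x : to_quot x^-1%g = ((to_quot x)^-1)%g.
Proof. by rewrite -quot_invE. Qed.

End QuotientGroup.

Section QuotientFinite.
Variables (G : profiniteGroupType) (N : openNormal G).

Lemma quot_finite_set : finite_set [set: quot N].
Proof.
pose pG : ptopologicalType := HB.pack (G : Type) (isPointed.Build G 1%g)
  (Topological.class G).
have := @profinite_compact G; rewrite (@compact_cover pG).
move=> /(_ G setT (fun g => [set x | openNormal_set N (g^-1 * x)%g])) [].
- move=> g _; have gcont : continuous (fun x : G => (g^-1 * x)%g).
    move=> x; apply: (@continuous_comp _ _ _
      (fun x : G => (g^-1%g, x)) (fun xy : G * G => (xy.1 * xy.2)%g)).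
      by apply: cvg_pair; [exact: cvg_cst|exact: cvg_id].
    exact: mulg_continuous.
  by apply: open_comp (openNormal_open N) => x _; exact: gcont.
- by move=> x _; exists x => //=; rewrite mulVg; exact: openNormal1.
- move=> D _ Dcov.
  have Dfin : finite_set (@to_quot G N @` [set` D]).
    exact: finite_image (finite_fset D).
  apply: sub_finite_set Dfin; elim/quotW=> x _.
  by have [//|g Dg Ngx] := Dcov x; exists g => //; exact/to_quotP.
Qed.

Definition quot_enum : seq (quot N) :=
  undup (projT1 (cid ((finite_seqP _).1 quot_finite_set))).

Lemma quot_enumP : Finite.axiom quot_enum.
Proof.
move=> a; rewrite count_uniq_mem ?undup_uniq// mem_undup.
case: cid => s /= s_eq; have : [set` s] a by rewrite -s_eq.
by move=> /= ->.
Qed.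

Definition quot_pickle (a : quot N) := index a quot_enum.
Definition quot_unpickle i := onth quot_enum i.

Lemma quot_pickleK : pcancel quot_pickle quot_unpickle.
Proof.
move=> a; have a_in : a \in quot_enum.
  by rewrite -has_pred1 has_count quot_enumP.
by rewrite /quot_unpickle onthE (nth_map a) ?index_mem// nth_index.
Qed.

HB.instance Definition _ := Choice_isCountable.Build (quot N) quot_pickleK.
HB.instance Definition _ := isFinite.Build (quot N) quot_enumP.

End QuotientFinite.

(* The group algebra k[gT] of a finite group, with the convolution product. *)
Definition group_algebra (k : fieldType) (gT : finGroupType) := {ffun gT -> k}.

Section GroupAlgebra.
Variables (k : fieldType) (gT : finGroupType).
Implicit Types (x y z : group_algebra k gT) (a b c : gT).
Local Open Scope ring_scope.

HB.instance Definition _ := GRing.Zmodule.on (group_algebra k gT).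

Definition ga_delta a : group_algebra k gT := [ffun b => (b == a)%:R].

Definition ga_mul x y : group_algebra k gT :=
  [ffun a => \sum_b x b * y (b^-1 * a)%g].

Lemma ga_mulA : associative ga_mul.
Proof.
move=> x y z; apply/ffunP => a; rewrite !ffunE.
under [RHS]eq_bigr do rewrite ffunE mulr_suml.
rewrite exchange_big; apply: eq_bigr => b _ /=.
rewrite ffunE mulr_sumr (reindex_inj (mulgI b^-1%g)) /=.
by apply: eq_bigr => c _; rewrite mulrA invgM invgK mulgA mulgK.
Qed.

Lemma ga_mul_deltal a y :
  ga_mul (ga_delta a) y = [ffun b => y (a^-1 * b)%g].
Proof.
apply/ffunP => b; rewrite !ffunE (bigD1 a) //= ffunE eqxx mul1r big1 ?addr0 //.
by move=> c /negPf c_a; rewrite ffunE c_a mul0r.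
Qed.

Lemma ga_mul_deltar x a :
  ga_mul x (ga_delta a) = [ffun b => x (b * a^-1)%g].
Proof.
apply/ffunP => b; rewrite !ffunE (bigD1 (b * a^-1)%g) //= ffunE.
rewrite invgM invgK mulgVK eqxx mulr1 big1 ?addr0 // => c /eqP c_ne.
rewrite ffunE; case: eqP => [ca|_]; last by rewrite mulr0.
by case: c_ne; rewrite -ca invgM invgK mulVKg.
Qed.

Lemma ga_mul1 : left_id (ga_delta 1%g) ga_mul.
Proof.
by move=> x; rewrite ga_mul_deltal; apply/ffunP => a; rewrite ffunE invg1 mul1g.
Qed.

Lemma ga_mulr1 : right_id (ga_delta 1%g) ga_mul.
Proof.
by move=> x; rewrite ga_mul_deltar; apply/ffunP => a; rewrite ffunE invg1 mulg1.
Qed.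

Lemma ga_mulDl : left_distributive ga_mul +%R.
Proof.
move=> x y z; apply/ffunP => a; rewrite !ffunE -big_split.
by apply: eq_bigr => b _; rewrite ffunE mulrDl.
Qed.

Lemma ga_mulDr : right_distributive ga_mul +%R.
Proof.
move=> x y z; apply/ffunP => a; rewrite !ffunE -big_split.
by apply: eq_bigr => b _; rewrite ffunE mulrDr.
Qed.

HB.instance Definition _ := GRing.Zmodule_isPzRing.Build (group_algebra k gT)
  ga_mulA ga_mul1 ga_mulr1 ga_mulDl ga_mulDr.

Lemma ga_deltaM a b : ga_delta (a * b)%g = ga_delta a * ga_delta b.
Proof.
rewrite [RHS]ga_mul_deltal; apply/ffunP => c.
by rewrite !ffunE -(inj_eq (mulgI a^-1%g)) mulKg.
Qed.

End GroupAlgebra.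

Section GroupAlgebraMap.
Variables (k : fieldType) (gT hT : finGroupType) (f : gT -> hT).
Implicit Types (x y : group_algebra k gT).
Local Open Scope ring_scope.

(* The k-linear extension of f. *)
Definition ga_map x : group_algebra k hT :=
  [ffun b => \sum_(a | f a == b) x a].

Lemma ga_map0 : ga_map 0 = 0.
Proof. by apply/ffunP => b; rewrite !ffunE big1 // => a _; rewrite ffunE. Qed.

Lemma ga_mapD x y : ga_map (x + y) = ga_map x + ga_map y.
Proof.
apply/ffunP => b; rewrite !ffunE -big_split.
by apply: eq_bigr => a _; rewrite ffunE.
Qed.

Lemma ga_mapN x : ga_map (- x) = - ga_map x.
Proof.
apply/ffunP => b; rewrite !ffunE -sumrN.
by apply: eq_bigr => a _; rewrite ffunE.
Qed.

Lemma ga_map_delta a : ga_map (ga_delta k a) = ga_delta k (f a).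
Proof.
apply/ffunP => b; rewrite !ffunE.
have [->|/eqP b_fa] := eqVneq b (f a).
  rewrite (bigD1 a) ?eqxx //= ffunE eqxx big1 ?addr0 // => c /andP[_ /negPf c_a].
  by rewrite ffunE c_a.
rewrite big1 // => c /eqP fc; rewrite ffunE; case: eqP => // c_a.
by case: b_fa; rewrite -fc c_a.
Qed.

Hypothesis fM : {morph f : a b / (a * b)%g >-> (a * b)%g}.

Lemma ga_mapM x y : ga_map (x * y) = ga_map x * ga_map y.
Proof.
apply/ffunP => b; rewrite !ffunE.
transitivity (\sum_a x a * \sum_(c | f (a * c)%g == b) y c).
  under eq_bigr do rewrite ffunE.
  rewrite exchange_big /=; apply: eq_bigr => a _.
  rewrite mulr_sumr (reindex_inj (mulgI a)) /=.
  by apply: eq_bigr => c _; rewrite mulKg.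
rewrite (partition_big f predT) //=; apply: eq_bigr => c _.
rewrite ffunE mulr_suml; apply: eq_bigr => a /eqP fa.
rewrite ffunE; congr (_ * _); apply: eq_bigl => d.
by rewrite fM fa -(inj_eq (mulgI c^-1%g)) mulKg.
Qed.

End GroupAlgebraMap.

(* The projection gN |-> gM, meaningful when N is contained in M. *)
Definition quot_map (G : topologicalGroupType) (N M : openNormal G)
    (a : quot N) : quot M := to_quot M (repr a).

Section QuotMap.
Variables (G : topologicalGroupType) (N M : openNormal G).
Hypothesis NM : N `<=` M.

Lemma quot_mapE (x : G) : quot_map M (to_quot N x) = to_quot M x.
Proof. by apply/to_quotP/NM/to_quotP; rewrite to_quotK. Qed.

Lemma quot_mapM :
  {morph @quot_map G N M : a b / (a * b)%g >-> (a * b)%g}.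
Proof.
elim/quotW=> x; elim/quotW=> y.
by rewrite -to_quotM !quot_mapE to_quotM.
Qed.

End QuotMap.

(* k[[G]]: the inverse limit of the k[G/N], as compatible families. *)
Record completed_group_algebra (k : fieldType) (G : profiniteGroupType) :=
  CompletedGroupAlgebra {
  cga_proj :> forall N : openNormal G, group_algebra k (quot N);
  cga_compat : forall N M : openNormal G, N `<=` M ->
    ga_map (@quot_map G N M) (cga_proj N) = cga_proj M
}.

Section CompletedGroupAlgebraRing.
Variables (k : fieldType) (G : profiniteGroupType).
Local Notation kG := (completed_group_algebra k G).
Implicit Types (x y z : kG) (g h : G) (N M : openNormal G).
Local Open Scope ring_scope.

HB.instance Definition _ := gen_eqMixin kG.
HB.instance Definition _ := gen_choiceMixin kG.

Lemma cga_ext x y : (forall N, x N = y N) -> x = y.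
Proof.
case: x y => [x xP] [y yP] /= xy; have {}xy : x = y.
  exact: functional_extensionality_dep.
by case: _ / xy in yP *; congr CompletedGroupAlgebra; exact: Prop_irrelevance.
Qed.

Definition cga_zero : kG.
Proof.
by exists (fun=> 0) => N M NM; exact: ga_map0.
Defined.

Definition cga_opp x : kG.
Proof.
by exists (fun N => - x N) => N M NM; rewrite ga_mapN cga_compat.
Defined.

Definition cga_add x y : kG.
Proof.
by exists (fun N => x N + y N) => N M NM; rewrite ga_mapD !cga_compat.
Defined.

(* The image of g under the canonical embedding of G into k[[G]]. *)
Definition cga_of g : kG.
Proof.
exists (fun N => ga_delta k (to_quot N g)) => N M NM.
by rewrite ga_map_delta quot_mapE.
Defined.

Definition cga_mul x y : kG.
Proof.
exists (fun N => x N * y N) => N M NM.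
by rewrite ga_mapM ?cga_compat//; exact: quot_mapM.
Defined.

Lemma cga_addA : associative cga_add.
Proof. by move=> x y z; apply: cga_ext => N; exact: addrA. Qed.
Lemma cga_addC : commutative cga_add.
Proof. by move=> x y; apply: cga_ext => N; exact: addrC. Qed.
Lemma cga_add0 : left_id cga_zero cga_add.
Proof. by move=> x; apply: cga_ext => N; exact: add0r. Qed.
Lemma cga_addN : left_inverse cga_zero cga_opp cga_add.
Proof. by move=> x; apply: cga_ext => N; exact: addNr. Qed.
Lemma cga_mulA : associative cga_mul.
Proof. by move=> x y z; apply: cga_ext => N; exact: mulrA. Qed.
Lemma cga_mul1 : left_id (cga_of 1%g) cga_mul.
Proof. by move=> x; apply: cga_ext => N; exact: mul1r. Qed.
Lemma cga_mulr1 : right_id (cga_of 1%g) cga_mul.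
Proof. by move=> x; apply: cga_ext => N; exact: mulr1. Qed.
Lemma cga_mulDl : left_distributive cga_mul cga_add.
Proof. by move=> x y z; apply: cga_ext => N; exact: mulrDl. Qed.
Lemma cga_mulDr : right_distributive cga_mul cga_add.
Proof. by move=> x y z; apply: cga_ext => N; exact: mulrDr. Qed.

HB.instance Definition _ := GRing.isPzRing.Build kG
  cga_addA cga_addC cga_add0 cga_addN
  cga_mulA cga_mul1 cga_mulr1 cga_mulDl cga_mulDr.

Lemma cga_ofM g h : cga_of (g * h)%g = cga_of g * cga_of h.
Proof. by apply: cga_ext => N /=; rewrite to_quotM ga_deltaM. Qed.

End CompletedGroupAlgebraRing.

Section BlockDecompositions.
Variable R : pzRingType.
Implicit Types (e f : R) (E : set R).
Local Open Scope ring_scope.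

Definition ring_center : set R := [set z | forall x, z * x = x * z].

Definition central_idempotent e := ring_center e /\ e * e = e.

Definition primitive_central_idempotent e :=
  [/\ central_idempotent e, e <> 0 &
      forall f1 f2, central_idempotent f1 -> central_idempotent f2 ->
        f1 * f2 = 0 -> e = f1 + f2 -> f1 = 0 \/ f2 = 0].

Definition ideal_of e : set R := [set x * e | x in [set: R]].

(* The last clause is R = \prod_(e in E) R e: the canonical map
   x |-> (x * e)_e is a bijection onto the (full, possibly infinite) product. *)
Definition block_decomposition E :=
  [/\ forall e, E e -> primitive_central_idempotent e,
      forall e f, E e -> E f -> e <> f -> e * f = 0 &
      forall y : R -> R, (forall e, E e -> ideal_of e (y e)) ->
        exists! x, forall e, E e -> x * e = y e].

Definition block_idempotent e := exists2 E, block_decomposition E & E e.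

End BlockDecompositions.

Section DefectGroups.
Variables (k : fieldType) (G : profiniteGroupType).
Local Notation kG := (completed_group_algebra k G).
Implicit Types (g : G) (H D : set G) (a e : kG) (B : set kG).
Local Open Scope ring_scope.

Definition cga_conj g a : kG := cga_of k g * a * cga_of k g^-1%g.

Definition cga_fixed H : set kG := [set a | forall h, H h -> cga_conj h a = a].

(* Sum over G/H, each coset being represented by a chosen element; the choice
   is immaterial on cga_fixed H, and G/H is finite for H open. *)
Definition trace H a : kG :=
  \sum_(C \in left_cosets H) cga_conj (xget 1%g C) a.

Definition otrace_image H : set kG :=
  [set a | forall N : openNormal G,
     (trace (setprod_group H N) @` cga_fixed (setprod_group H N)) a].

Definition is_block B e := block_idempotent e /\ B = ideal_of e.

Definition is_defect_group e D :=
  [/\ closed_subgroup D, otrace_image D e &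
      forall D' : set G, closed_subgroup D' -> otrace_image D' e ->
        D' `<=` D -> D' = D].

End DefectGroups.

(* Main.v *)
(** Zorn's lemma applies to the closed subgroups [H] with [e] in the image of
    the open trace from [H]. The subgroup [G] is one of them because [e] is
    central. If [D] is the intersection of a chain of them, then for every open
    normal [N] compactness puts some member [H] of the chain inside the open
    set [D N], so that [H N = D N] and the trace condition for [D] at [N] is the
    one for [H] at [N]. *)
Require Import Defs.
From HB Require Import structures.
From mathcomp Require Import all_boot all_algebra all_fingroup.
From mathcomp Require Import finmap all_classical topology.

Set Implicit Arguments.
Unset Strict Implicit.
Unset Printing Implicit Defensive.

Import GRing.Theory.

Local Open Scope classical_set_scope.

(** If every member of the chain met the complement of [U], the sets [H \ U] would be a filter base
    of nonempty closed sets. A cluster point, which exists by compactness, would lie in all of them,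
    hence in the intersection but outside [U]. *)
Lemma compact_chain_sub_open (T : topologicalType) (A : set (set T))
    (U : set T) :
  compact [set: T] -> A !=set0 -> total_on A subset ->
  (forall H, A H -> closed H) -> open U -> \bigcap_(H in A) H `<=` U ->
  exists2 H, A H & H `<=` U.
Proof.
move=> Tcompact A0 Atot Aclosed Uopen AU; apply: contrapT => noH.
pose F := filter_from A (fun H => H `\` U).
have FF : ProperFilter F.
  apply: filter_from_proper; last first.
    move=> H AH; apply: contrapT => HU0; apply: noH; exists H => // x Hx.
    by apply: contrapT => nUx; apply: HU0; exists x.
  apply: filter_from_filter => // H K AH AK.
  (* Of two members of the chain, the smaller one refines both. *)
  have [HK|KH] := Atot _ _ AH AK; [exists H|exists K] => // x [xH nUx].
    by split; split=> //; exact: HK.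
  by split; split=> //; exact: KH.
have [x [_ xF]] := Tcompact F FF filterT.
have xclos H : A H -> (H `\` U) x.
  move=> AH; have HUclosed : closed (H `\` U).
    by rewrite setDE; apply: closedI; [exact: Aclosed|exact: open_closedC].
  (* A cluster point lies in the closure of each set of the filter, and [H \ U] is closed. *)
  by move: xF; rewrite clusterE => /(_ (H `\` U)) xcl; apply/HUclosed/xcl; exists H.
have [H0 AH0] := A0.
by have [_] := xclos _ AH0; apply; apply: AU => H /xclos[].
Qed.

Section Subgroups.
Variable G : groupType.
Implicit Types (H K : set G) (A : set (set G)).

Lemma is_subgroupP H :
  is_subgroup H <-> H 1%g /\ forall x y, H x -> H y -> H (x * y^-1)%g.
Proof.
split=> [[/set_mem H1 HV]|[H1 HV]]; split=> //; last 2 first.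
- exact: mem_set.
- by move=> x y /set_mem Hx /set_mem Hy; apply/mem_set/HV.
by move=> x y Hx Hy; apply/set_mem/HV; exact: mem_set.
Qed.

Lemma is_subgroup_setT : is_subgroup [set: G].
Proof. by apply/is_subgroupP. Qed.

Lemma is_subgroup_bigcap A :
  (forall H, A H -> is_subgroup H) -> is_subgroup (\bigcap_(H in A) H).
Proof.
move=> Asub; apply/is_subgroupP; split=> [H /Asub/is_subgroupP[]//|x y xA yA H AH].
by have /is_subgroupP[_] := Asub H AH; apply; [exact: xA|exact: yA].
Qed.

Lemma setprod_groupS H H' K :
  H `<=` H' -> setprod_group H K `<=` setprod_group H' K.
Proof. by move=> HH' _ [h Hh [x Kx <-]]; exists h; [exact: HH'|exists x]. Qed.

End Subgroups.

Section OpenNormalProduct.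
Variables (G : topologicalGroupType) (N : openNormal G).
Implicit Types H K : set G.

Lemma sub_setprod_group H : H `<=` setprod_group H N.
Proof.
by move=> h Hh; exists h => //; exists 1%g; [exact: openNormal1|rewrite mulg1].
Qed.

(** [N] absorbs the extra factor: [(x n) n' = x (n n')]. *)
Lemma setprod_group_sub H K :
  H `<=` setprod_group K N -> setprod_group H N `<=` setprod_group K N.
Proof.
move=> HKN _ [h /HKN[x Kx [n Nn <-]] [n' Nn' <-]]; exists x => //.
by exists (n * n')%g; [exact: openNormalM|rewrite mulgA].
Qed.

(** The product is a union of translates [h N], each the preimage of [N] under the continuous map
    sending [x] to [h^-1 x]. *)
Lemma open_setprod_group H : open (setprod_group H N).
Proof.
have -> : setprod_group H N = \bigcup_(h in H) [set x | openNormal_set N (h^-1 * x)%g].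
  apply/seteqP; split=> [_ [h Hh [n Nn <-]]|x [h Hh Nx]]; exists h => //=.
    by rewrite mulKg.
  by exists (h^-1 * x)%g => //; rewrite mulVKg.
apply: bigcup_open => h _; have hcont : continuous (fun x : G => (h^-1 * x)%g).
  move=> x; apply: (@continuous_comp _ _ _
    (fun x : G => (h^-1%g, x)) (fun xy : G * G => (xy.1 * xy.2)%g)).
    by apply: cvg_pair; [exact: cvg_cst|exact: cvg_id].
  exact: mulg_continuous.
by apply: open_comp (openNormal_open N) => x _; exact: hcont.
Qed.

End OpenNormalProduct.

Section OpenTrace.
Variables (k : fieldType) (G : profiniteGroupType).
Implicit Types (a e : completed_group_algebra k G) (g : G).
Local Open Scope ring_scope.

Lemma cga_conj_central a g : ring_center a -> cga_conj g a = a.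
Proof. by move=> aZ; rewrite /cga_conj -aZ -mulrA -cga_ofM mulgV mulr1. Qed.

(** There is a single coset, and its representative, whichever element [xget] picks, fixes [a]. *)
Lemma trace_setT a : cga_fixed [set: G] a -> trace [set: G] a = a.
Proof.
move=> afix; rewrite /trace.
have -> : left_cosets [set: G] = [set setT].
  have cosetT g : left_coset [set: G] g = setT.
    by apply/seteqP; split=> // x _; exists (g^-1 * x)%g => //; rewrite mulVKg.
  apply/seteqP; split=> [_ [g _ <-]|_ ->]; first exact: cosetT.
  by exists 1%g.
by rewrite fsbig_set1 afix.
Qed.

Lemma otrace_image_setT a : ring_center a -> otrace_image [set: G] a.
Proof.
move=> aZ N; have -> : setprod_group [set: G] N = setT.
  by apply/seteqP; split=> // x _; apply: sub_setprod_group.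
have afix : cga_fixed [set: G] a by move=> g _; exact: cga_conj_central.
by exists a => //; exact: trace_setT.
Qed.

Lemma otrace_image_bigcap (A : set (set G)) a :
  A !=set0 -> total_on A subset -> (forall H, A H -> closed H) ->
  (forall H, A H -> otrace_image H a) -> otrace_image (\bigcap_(H in A) H) a.
Proof.
move=> A0 Atot Aclosed Atr N; set D := \bigcap_(H in A) H.
have [H AH HDN] : exists2 H, A H & H `<=` setprod_group D N.
  apply: compact_chain_sub_open => //; [exact: profinite_compact|
    exact: open_setprod_group|exact: sub_setprod_group].
suff -> : setprod_group D N = setprod_group H N by exact: Atr.
apply/seteqP; split; last exact: setprod_group_sub.
(* The intersection [D] lies in the member [H]. *)
by apply: setprod_groupS => x; apply.
Qed.

End OpenTrace.

Theorem theorem5p2 (p : nat) (k : fieldType) (p_char : p \in [pchar k]%R)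
    (G : profiniteGroupType) (B : set (completed_group_algebra k G))
    (e : completed_group_algebra k G) (B_block : is_block B e) :
  exists D : set G, is_defect_group e D.
Proof.
have [[E [Eprim _ _] Ee] _] := B_block.
have [[eZ _] _ _] := Eprim e Ee.
pose P (H : set G) := closed_subgroup H /\ otrace_image H e.
pose T := {H : set G | P H}.
have PT : P setT.
  by split; [split; [exact: is_subgroup_setT|exact: closedT]|
    exact: otrace_image_setT].
have [| | |A Atot|[D [Dsub Dtr]] Dmin] :=
  (* The order is reverse inclusion: maximal elements are minimal subgroups, and an upper bound of a
     chain is a subgroup contained in all its members. *)
  @Zorn T (fun H K => `[< sval K `<=` sval H >]).
- by move=> H; apply/asboolP.
- by move=> H K L /asboolP KH /asboolP LK; apply/asboolP => x /LK/KH.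
- move=> [H PH] [K PK] /asboolP/= KH /asboolP/= HK; apply: eq_exist.
  by apply/seteqP; split.
- have [A0|/nonemptyPn A0] := pselect (A !=set0); last first.
    (* The empty chain is bounded by [G] itself; the compactness argument covers nonempty chains. *)
    by exists (exist P setT PT) => H; rewrite A0.
  pose A' := [set sval H | H in A].
  have PA' H : A' H -> P H by move=> [K _ <-]; exact: (svalP K).
  have PD : P (\bigcap_(H in A') H).
    split; [split|].
    + by apply: is_subgroup_bigcap => H /PA'[[]].
    + by apply: closed_bigI => H /PA'[[]].
    + apply: otrace_image_bigcap => [|_ _ [H AH <-] [K AK <-]||].
      * by have [H AH] := A0; exists (sval H), H.
      * by have [/asboolP KH|/asboolP HK] := Atot _ _ AH AK; [right|left].
      * by move=> H /PA'[[]].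
      * by move=> H /PA'[].
  by exists (exist P _ PD) => H AH; apply/asboolP => x /=; apply; exists H.
exists D; split=> // K Ksub Ktr KD.
(* Maximality yields an equality in the subtype [T], whose first component is [K = D]. *)
by have [] := Dmin (exist P K (conj Ksub Ktr)) (asboolT KD).
Qed.
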